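(* Let $X,Y$ be real locally convex topological vector spaces, let $A\colon X\to Y$ be a continuous linear mapping, and let $f\colon Y\to(-\infty,\infty]$ be a polyhedral convex function. Assume that the range of $A$ contains a point of $\mathrm{dom}(f)$. Then for every $\bar x\in X$ with $\bar y:=A(\bar x)\in\mathrm{dom}(f)$ we have $$\partial(f\circ A)(\bar x)=A^*\big(\partial f(\bar y)\big):=\{A^*y^*\mid y^*\in\partial f(\bar y)\}.$$
   Context: $A^*\colon Y^*\to X^*$ is the adjoint of $A$. $\mathrm{dom}(f):=\{y\in Y\mid f(y)<\infty\}$ and $\mathrm{epi}(f):=\{(y,\lambda)\in Y\times\mathbb{R}\mid f(y)\le\lambda\}$. A subset $P$ of a locally convex space $Z$ is a convex polyhedron if $P=\{z\in Z\mid\langle z_i^*,z\rangle\le\alpha_i,\ i=1,\dots,k\}$ for finitely many $z_i^*\in Z^*$, $\alpha_i\in\mathbb{R}$; $f$ is polyhedral if $\mathrm{epi}(f)$ is a convex polyhedron in $Y\times\mathbb{R}$. For a convex function $h\colon X\to(-\infty,\infty]$ and $\bar x\in\mathrm{dom}(h)$, $\partial h(\bar x):=\{x^*\in X^*\mid\langle x^*,x-\bar x\rangle\le h(x)-h(\bar x)\text{ for all }x\in X\}$. *)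

(* Defs.v *)
From HB Require Import structures.
From mathcomp Require Import all_boot all_order all_algebra.
From mathcomp Require Import all_classical all_reals all_analysis.

Set Implicit Arguments.
Unset Strict Implicit.
Unset Printing Implicit Defensive.

Import Order.TTheory GRing.Theory Num.Theory.
Import numFieldNormedType.Exports.

Local Open Scope classical_set_scope.
Local Open Scope ring_scope.
Local Open Scope ereal_scope.

Section continuous_linear.
Context {R : realType}.

(* No Hausdorff axiom is imposed: [tvsType] does not include one. *)
Record continuous_linear (X Y : tvsType R) := ContinuousLinear {
  clin_linear :> {linear X -> Y} ;
  clin_continuous : continuous clin_linear
}.

Arguments clin_continuous {X Y} _.

Lemma continuous_linearP (X Y : tvsType R) (A B : continuous_linear X Y) :
  (forall x, A x = B x) -> A = B.
Proof.
case: A B => [[A [[A1] [A2]]] cA] [[B [[B1] [B2]]] cB] /= AB.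
have {}AB : A = B by exact/funext.
subst B; rewrite (Prop_irrelevance A1 B1) (Prop_irrelevance A2 B2) in cA *.
by rewrite (Prop_irrelevance cA cB).
Qed.

Lemma comp_clin_continuous (X Y Z : tvsType R) (B : continuous_linear Y Z)
    (A : continuous_linear X Y) :
  continuous (clin_linear B \o clin_linear A : {linear X -> Z}).
Proof.
by move=> x; apply: continuous_comp; exact: clin_continuous.
Qed.

Definition comp_clin (X Y Z : tvsType R) (B : continuous_linear Y Z)
    (A : continuous_linear X Y) : continuous_linear X Z :=
  ContinuousLinear (@comp_clin_continuous _ _ _ B A).

Definition dual (Z : tvsType R) := continuous_linear Z R^o.

Definition adjoint (X Y : tvsType R) (A : continuous_linear X Y) :
  dual Y -> dual X := fun ystar => comp_clin ystar A.

End continuous_linear.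

Section convex_analysis.
Context {R : realType}.

Definition dom (Y : Type) (f : Y -> \bar R) : set Y := [set y | f y < +oo].

Definition epi (Y : tvsType R) (f : Y -> \bar R) : set (Y * R^o)%type :=
  [set p | f p.1 <= p.2%:E].

Definition convex_polyhedron (Z : tvsType R) (P : set Z) : Prop :=
  exists (k : nat) (zstar : 'I_k -> dual Z) (alpha : 'I_k -> R),
    P = [set z | forall i, (zstar i z <= alpha i)%R].

Definition polyhedral (Y : tvsType R) (f : Y -> \bar R) : Prop :=
  convex_polyhedron (epi f).

(* Meant for h with values in (-oo, +oo] and xbar in dom h, so that h xbar is
   finite and the right-hand side is never of the form +oo - +oo. *)
Definition subdifferential (X : tvsType R) (h : X -> \bar R) (xbar : X) :
    set (dual X) :=
  [set xstar | forall x, (xstar (x - xbar)%R)%:E <= h x - h xbar].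

End convex_analysis.

(* Main.v *)
Require Import Defs.
From HB Require Import structures.
From mathcomp Require Import all_boot all_order all_algebra.
From mathcomp Require Import all_classical all_reals all_analysis.
From mathcomp Require Import ring.
Import Order.TTheory GRing.Theory Num.Theory.
Import numFieldNormedType.Exports.
Local Open Scope classical_set_scope.
Local Open Scope ereal_scope.

(** A subgradient of [h] at [xbar] is a linear functional such that
    [xstar (x - xbar) - (lambda - h xbar) <= 0] for every [(x, lambda)] in the
    epigraph of [h].  When the epigraph of [f] is cut out by finitely many
    inequalities [z_i <= alpha_i] on [Y * R], the epigraph of [f \o A] is cut
    out by the pulled-back functionals [z_i (A x, t)].  The constraints that
    are not active at [(xbar, f (A xbar))] do not restrict small moves away
    from that point ([small_step]), so a subgradient [xstar] of [f \o A] gives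
    a functional [xstar d - t] that is nonpositive wherever the active
    [z_i (A d, t)] are nonpositive.  By Farkas' lemma ([farkas]) it is then a
    nonnegative combination [\sum mu_i z_i (A d, t)].  The same multipliers
    make sense on [Y * R], before composing with [A]:
    [ystar := \sum mu_i z_i (_, 0)] satisfies [ystar \o A = xstar], and
    nonnegativity of the [mu_i] makes it a subgradient of [f].

    Farkas' lemma is proved by elimination on an arbitrary vector space: for
    finitely many functionals it is a purely algebraic fact, so the topology
    of [Y] matters only for the continuity of [ystar], which is inherited from
    the [z_i]. *)

(** Induction on the number of constraints.  If the first constraint
    [g i] is redundant its multiplier is zero.  Otherwise some [v] satisfies the
    remaining constraints but has [h v > 0], hence [g i v > 0]; projecting
    along [v] onto the kernel of [g i] reduces to the remaining constraints,
    and the multiplier of [g i] is then forced by evaluating at [v]; it is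
    nonnegative because [h v > 0] while the other [g j v] are nonpositive. *)
Lemma farkas (R : realFieldType) (V : lmodType R) (I : eqType) (s : seq I)
    (g : I -> {linear V -> R^o}) (h : {linear V -> R^o}) :
  uniq s ->
  (forall v, (forall i, i \in s -> (g i v <= 0)%R) -> (h v <= 0)%R) ->
  exists2 mu : I -> R, (forall i, (0 <= mu i)%R) &
    forall v, h v = (\sum_(i <- s) mu i * g i v)%R.
Proof.
elim: s g h => [|i s IH] g h /=.
  move=> _ h_le0; exists (fun=> 0%R) => // v; rewrite big_nil.
  apply/eqP; rewrite eq_le h_le0//=.
  by have := h_le0 (- v)%R; rewrite linearN oppr_le0; apply.
move=> /andP[iNs s_uniq] h_le0.
have update (mu : I -> R) c v :
    (\sum_(j <- i :: s) (if j == i then c else mu j) * g j v =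
     c * g i v + \sum_(j <- s) mu j * g j v)%R.
  rewrite big_cons eqxx; congr (_ + _)%R.
  apply: eq_big_seq => j js; case: eqP => // ji.
  by rewrite -ji js in iNs.
have [redundant|] := pselect (forall v,
    (forall j, j \in s -> (g j v <= 0)%R) -> (h v <= 0)%R).
  have [mu mu_ge0 hE] := IH g h s_uniq redundant.
  exists (fun j => if j == i then 0%R else mu j) => [j|v]; first by case: ifP.
  by rewrite update mul0r add0r.
move=> /existsNP[v /not_implyP[gv_le0 /negP]]; rewrite -ltNge => hv_gt0.
have giv_gt0 : (0 < g i v)%R.
  rewrite ltNge; apply/negP => giv_le0; move: hv_gt0; apply/negP.
  rewrite -leNgt; apply: h_le0 => j.
  by rewrite in_cons => /predU1P[->//|]; exact: gv_le0.
have giv_neq0 : g i v != 0%R by rewrite gt_eqF.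
pose proj (k : {linear V -> R^o}) : {linear V -> R^o} :=
  (k \- (k v / g i v)%R \*: g i)%R.
have projE k w : (proj k w = k (w - (g i w / g i v) *: v))%R.
  rewrite linearB linearZ /= /GRing.scale/=; field => //.
have [|mu mu_ge0 hE] := IH (proj \o g) (proj h) s_uniq.
  move=> w w_le0; rewrite projE; apply: h_le0 => j.
  rewrite in_cons => /predU1P[->|js]; last by rewrite -projE; exact: w_le0.
  by rewrite linearB linearZ /= /GRing.scale/= divfK// subrr.
pose c := ((h v - \sum_(j <- s) mu j * g j v) / g i v)%R.
exists (fun j => if j == i then c else mu j) => [j|w].
  case: ifP => // _; rewrite divr_ge0 ?(ltW giv_gt0)// subr_ge0.
  apply: le_trans (ltW hv_gt0); rewrite big_seq; apply: sumr_le0 => l ls.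
  by rewrite mulr_ge0_le0// gv_le0.
rewrite update.
have := hE w; rewrite /proj /= /GRing.scale/= => /eqP.
rewrite subr_eq => /eqP ->.
under eq_bigr do rewrite mulrBr.
rewrite sumrB.
under [X in (_ - X)%R]eq_bigr do rewrite !mulrA.
rewrite -!mulr_suml /c; ring.
Qed.

(** A direction that does not increase the active constraints of a feasible
    point is feasible for a short time. *)
Lemma small_step (R : realType) (I : finType) (a b alpha : I -> R) :
  (forall i, a i <= alpha i)%R ->
  (forall i, a i = alpha i -> b i <= 0)%R ->
  exists2 e : R, (0 < e)%R & forall i, (a i + e * b i <= alpha i)%R.
Proof.
move=> a_le b_le0.
have small i : \forall e \near (0%R : R)^'+, (a i + e * b i <= alpha i)%R.
  have [bi_le0|bi_gt0] := leP (b i) 0%R.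
    by near=> e; rewrite -[leRHS]addr0 lerD// mulr_ge0_le0.
  have ai_lt : (a i < alpha i)%R.
    rewrite lt_neqAle a_le andbT; apply/eqP => /b_le0.
    by rewrite leNgt bi_gt0.
  near=> e; rewrite -lerBrDl -ler_pdivlMr//.
  by near: e; apply: nbhs_right_le; rewrite divr_gt0// subr_gt0.
have /filter_ex[e [e_gt0 eP]] : \forall e \near (0%R : R)^'+,
    (0 < e)%R /\ forall i, (a i + e * b i <= alpha i)%R.
  by near=> e; split; near: e;
    [exact: nbhs_right_gt|exact: filter_forall].
by exists e.
Unshelve. all: by end_near. Qed.

(** Quantifying over the epigraph makes the subgradient inequality real-valued
    and linear in [(x, l)], the form that Farkas' lemma can use; points where
    [h] is infinite impose nothing. *)
Lemma subdifferential_epi (R : realType) (X : tvsType R) (h : X -> \bar R)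
    (xbar : X) (r : R) (xstar : dual X) :
  (forall x, -oo < h x) -> h xbar = r%:E ->
  subdifferential h xbar xstar <->
  forall x (l : R), epi h (x, l) -> (xstar (x - xbar) <= l - r)%R.
Proof.
move=> h_ninfty hr; rewrite /subdifferential /epi /= hr; split.
  move=> xsub x l hl; rewrite -lee_fin EFinB.
  by apply: le_trans (xsub x) _; exact: leeB.
move=> xsub x; case E : (h x) (h_ninfty x) => [l| |]// _.
  by rewrite -EFinB lee_fin xsub//= E.
by rewrite addye// leey.
Qed.

Section pullback.
Context {R : realType} {X Y : tvsType R}.
Implicit Types (A : continuous_linear X Y) (z : dual (Y * R^o)%type).

Definition pullback A z (p : X * R^o) : R^o := z (A p.1, p.2).

Lemma pullback_is_linear A z : linear (pullback A z).
Proof. by move=> a p q; rewrite /pullback -linearP/= linearP. Qed.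

HB.instance Definition _ A z :=
  GRing.isLinear.Build R (X * R^o)%type R^o _ (pullback A z)
    (pullback_is_linear A z).

(** At a displacement [(d, t)] from [(xbar, h xbar)], the gap that a subgradient
    [xstar] of [h] keeps nonpositive on the epigraph of [h]. *)
Definition slope (xstar : dual X) (p : X * R^o) : R^o := (xstar p.1 - p.2)%R.

Lemma slope_is_linear xstar : linear (slope xstar).
Proof.
by move=> a p q; rewrite /slope /= linearP /= scalerBr opprD addrACA.
Qed.

HB.instance Definition _ xstar :=
  GRing.isLinear.Build R (X * R^o)%type R^o _ (slope xstar)
    (slope_is_linear xstar).

End pullback.

Section combination.
Context {R : realType} {Y : tvsType R} {I : finType} (P : pred I).
Context (mu : I -> R) (z : I -> dual (Y * R^o)%type).

(** The horizontal part of the functional [\sum mu_i z_i] on [Y * R]. *)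
Definition combination (y : Y) : R^o :=
  (\sum_(i | P i) mu i * z i (y, 0))%R.

Lemma combination_is_linear : linear combination.
Proof.
move=> a u v; rewrite /combination scaler_sumr -big_split /=.
apply: eq_bigr => i _.
have -> : ((a *: u + v, 0) = a *: (u, 0) + (v, 0) :> Y * R^o)%R.
  by congr (_, _); rewrite /= scaler0 addr0.
by rewrite linearP /= /GRing.scale/= mulrDr mulrCA.
Qed.

HB.instance Definition _ :=
  GRing.isLinear.Build R Y R^o _ combination combination_is_linear.

Lemma combination_continuous : continuous (combination : Y -> R^o).
Proof.
move=> y; apply: cvg_big => [|i _]; first exact: add_continuous.
apply: cvgMl_tmp.
have pairc : (fun y : Y => (y, 0%R) : Y * R^o) @ y --> (y, 0%R : R^o).
  by apply: (@cvg_pair _ _ _ _ (nbhs y) (nbhs (0%R : R^o)));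
    [exact: cvg_id|exact: cvg_cst].
exact: (cvg_comp _ _ pairc (@clin_continuous _ _ _ (z i) (y, 0%R))).
Qed.

Definition combination_dual : dual Y :=
  ContinuousLinear combination_continuous.

End combination.

Theorem corollary5p9 (R : realType) (X Y : tvsType R)
  (A : continuous_linear X Y) (f : Y -> \bar R)
  (f_ninfty : forall y, -oo < f y)
  (f_convex : convex_set (epi f))
  (f_polyhedral : polyhedral f)
  (range_dom : range A `&` dom f !=set0) :
  forall xbar : X, dom f (A xbar) ->
    subdifferential (f \o A) xbar =
    [set adjoint A ystar | ystar in subdifferential f (A xbar)].
Proof.
move=> xbar; rewrite /dom/= => fA_fin.
have [r fr] : exists r : R, f (A xbar) = r%:E.
  by case: (f (A xbar)) (f_ninfty (A xbar)) fA_fin => // r; exists r.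
apply/seteqP; split; last first.
  by move=> _ [ystar ysub <-] x; rewrite /= linearB; exact: ysub.
move=> xstar /(subdifferential_epi _ _ _ _ r _ (fun x => f_ninfty (A x)) fr).
move=> xsub.
have [k [z [alpha epiE]]] := f_polyhedral.
have epiP p : epi f p <-> forall i, (z i p <= alpha i)%R by rewrite epiE.
pose p0 : Y * R^o := (A xbar, r).
have p0_le : forall i, (z i p0 <= alpha i)%R.
  by apply/epiP; rewrite /epi/= fr.
pose active := [pred i | z i p0 == alpha i].
(* Nonpositivity on the epigraph near [p0] passes to the cone of feasible
   directions by scaling down. *)
have slope_le0 p :
    (forall i, i \in enum active -> (pullback A (z i) p <= 0)%R) ->
    (slope xstar p <= 0)%R.
  move=> p_le0.
  have [i ziE|e e_gt0 eP] :=
    small_step _ _ (fun i => z i p0) (fun i => pullback A (z i) p) _ p0_le.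
    by apply: p_le0; rewrite mem_enum inE ziE.
  have : epi (f \o A) (xbar + e *: p.1, r + e * p.2)%R.
    suff : epi f (p0 + e *: (A p.1, p.2 : R^o))%R.
      by rewrite /epi /= linearD linearZ.
    apply/epiP => i; rewrite linearD linearZ; exact: eP.
  move=> /xsub; rewrite addrC addKr addrC addKr linearZ /= /GRing.scale/=.
  by rewrite ler_pM2l// /slope subr_le0.
have [mu mu_ge0 slopeE] := farkas _ _ _ (enum active)
  (fun i => pullback A (z i) : {linear _ -> _}) (slope xstar : {linear _ -> _})
  (enum_uniq _) slope_le0.
have xstarE x (t : R) :
    (xstar x - t = \sum_(i in active) mu i * z i (A x, t : R^o))%R.
  by have := slopeE (x, t); rewrite big_enum.
exists (combination_dual active mu z); last first.
  by apply: continuous_linearP => x /=; rewrite /combination -xstarE subr0.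
apply/(subdifferential_epi _ _ _ _ r _ f_ninfty fr) => y l /epiP yl_le.
(* At [x = 0] the multipliers also represent the vertical functional [- t], so
   the gap [ystar (y - A xbar) - (l - r)] is itself a combination of active
   constraints. *)
have vertical : (- (l - r) = \sum_(i in active) mu i * z i (0, l - r : R^o))%R.
  by have := xstarE 0%R (l - r)%R; rewrite !linear0 sub0r.
rewrite -subr_le0 vertical -big_split /=; apply: sumr_le0 => i /eqP ziE.
rewrite -mulrDr -linearD mulr_ge0_le0//.
have -> : ((y - A xbar, 0) + (0, l - r) = (y, l) - p0 :> Y * R^o)%R.
  by congr (_, _); rewrite /= ?addr0 ?add0r.
by rewrite linearB subr_le0 ziE.
Qed.
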